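(* Let $S$ be an LA-semigroup. An ideal $I$ of $S$ is prime if and only if it is semiprime and strongly irreducible.
   Context: An LA-semigroup (left almost semigroup) is a set $S$ with a binary operation satisfying the left invertive law $(ab)c=(cb)a$ for all $a,b,c\in S$ (the operation is not assumed associative). For subsets $A,B\subseteq S$, $AB=\{ab: a\in A, b\in B\}$ and $A^2=AA$. A subset $I\subseteq S$ is a right (left) ideal if $IS\subseteq I$ ($SI\subseteq I$), and an ideal if it is both. An ideal $P$ of $S$ is prime if for all ideals $A,B$ of $S$, $AB\subseteq P$ implies $A\subseteq P$ or $B\subseteq P$. An ideal $P$ is semiprime if for every ideal $J$ of $S$, $J^2\subseteq P$ implies $J\subseteq P$. An ideal $I$ is strongly irreducible if for all ideals $H,K$ of $S$, $H\cap K\subseteq I$ implies $H\subseteq I$ or $K\subseteq I$. *)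

(* Defs.v *)
From HB Require Import structures.
From mathcomp Require Import all_boot.
From mathcomp Require Import classical_sets.

Set Implicit Arguments.
Unset Strict Implicit.
Unset Printing Implicit Defensive.

Local Open Scope classical_set_scope.

(* The operation is that of the underlying magma, written x * y in
   group_scope; it is not assumed associative or unital. *)
HB.mixin Record Magma_isLASemigroup S of Magma S := {
  left_invertive : forall a b c : S, ((a * b) * c = (c * b) * a)%g
}.

#[short(type="laSemigroupType")]
HB.structure Definition LASemigroup := {S of Magma_isLASemigroup S & Magma S}.

Definition prodset (S : magmaType) (A B : set S) : set S :=
  [set (a * b)%g | a in A & b in B].

Definition right_ideal (S : laSemigroupType) (I : set S) : Prop :=
  prodset I [set: S] `<=` I.

Definition left_ideal (S : laSemigroupType) (I : set S) : Prop :=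
  prodset [set: S] I `<=` I.

(* Ideals are not required to be nonempty: set0 is an ideal. *)
Definition ideal (S : laSemigroupType) (I : set S) : Prop :=
  right_ideal I /\ left_ideal I.

Definition prime_ideal (S : laSemigroupType) (P : set S) : Prop :=
  ideal P /\
  forall A B : set S, ideal A -> ideal B ->
    prodset A B `<=` P -> A `<=` P \/ B `<=` P.

Definition semiprime_ideal (S : laSemigroupType) (P : set S) : Prop :=
  ideal P /\
  forall J : set S, ideal J -> prodset J J `<=` P -> J `<=` P.

Definition strongly_irreducible_ideal (S : laSemigroupType) (I : set S) : Prop :=
  ideal I /\
  forall H K : set S, ideal H -> ideal K ->
    H `&` K `<=` I -> H `<=` I \/ K `<=` I.

(* Main.v *)
Require Import Defs.
From mathcomp Require Import all_boot.
From mathcomp Require Import classical_sets.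

(** For ideals [A] and [B], the product [AB] and the intersection of [A] and
    [B] are interchangeable as tests for containment in a semiprime ideal.
    On the one hand [AB] lies in the intersection ([prodset_subI]), so a
    primality hypothesis on products applies to intersections: prime ideals are
    strongly irreducible, and the case [A = B] shows that they are semiprime.
    On the other hand the intersection is an ideal ([idealI]) whose square
    lies in [AB]; if [AB] lies in a semiprime ideal, so does the intersection,
    and strong irreducibility then puts [A] or [B] inside. *)

Local Open Scope classical_set_scope.

Lemma prodsetSS {S : magmaType} {A B C D : set S} :
  A `<=` C -> B `<=` D -> prodset A B `<=` prodset C D.
Proof.
by move=> sAC sBD _ [a Aa [b Bb <-]]; exists a; [exact: sAC | exists b; [exact: sBD |]].
Qed.

Lemma idealI (S : laSemigroupType) (A B : set S) :
  ideal A -> ideal B -> ideal (A `&` B).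
Proof.
move=> [rA lA] [rB lB]; split; rewrite /right_ideal /left_ideal subsetI; split.
- exact: subset_trans (prodsetSS (@subIsetl _ A B) (@subset_refl _ _)) rA.
- exact: subset_trans (prodsetSS (@subIsetr _ A B) (@subset_refl _ _)) rB.
- exact: subset_trans (prodsetSS (@subset_refl _ _) (@subIsetl _ A B)) lA.
- exact: subset_trans (prodsetSS (@subset_refl _ _) (@subIsetr _ A B)) lB.
Qed.

(** A product [ab] lies in [A] because [A] absorbs [b] on the right, and in [B]
    because [B] absorbs [a] on the left. *)
Lemma prodset_subI (S : laSemigroupType) (A B : set S) :
  right_ideal A -> left_ideal B -> prodset A B `<=` A `&` B.
Proof.
move=> rA lB; rewrite subsetI; split.
- exact: subset_trans (prodsetSS (@subset_refl _ A) (@subsetT _ B)) rA.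
- exact: subset_trans (prodsetSS (@subsetT _ A) (@subset_refl _ B)) lB.
Qed.

Theorem proposition4 (S : laSemigroupType) (I : set S) (hI : ideal I) :
  prime_ideal I <-> semiprime_ideal I /\ strongly_irreducible_ideal I.
Proof.
split=> [[_ primeI] | [[_ semiprimeI] [_ irrI]]].
- split; split=> //.
  + by move=> J idJ JJ_I; case: (primeI J J idJ idJ JJ_I).
  + move=> H K idH idK HK_I; apply: primeI => //.
    by apply: subset_trans HK_I; apply: prodset_subI; [case: idH | case: idK].
- split=> // A B idA idB AB_I; apply: irrI => //.
  apply: semiprimeI; first exact: idealI.
  apply: subset_trans AB_I.
  exact: prodsetSS (@subIsetl _ A B) (@subIsetr _ A B).
Qed.
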